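(* Let $R$ be a principal ideal domain that is not a field. For any $r, s \in R^0$, one has $r \in \sigma_s^0$ if and only if $\operatorname{supp}(r) \cap \operatorname{supp}(s) = \emptyset$. In particular, the basic open sets of $M(R)$ depend exclusively on prime support.
   Context: For a commutative integral domain $R$ with $1 \neq 0$ that is not a field, write $R^0 = R \setminus \{0\}$. For $k \in R^0$ let $\sigma_k^0 := \{s \in R^0 : \langle k \rangle + \langle s \rangle = R\}$, where $\langle k \rangle$ is the principal ideal generated by $k$. The sets $\sigma_k^0$ ($k \in R^0$) form a basis of a topology on $R^0$; the Macías space $M(R)$ is the set $R^0$ with this topology, and the $\sigma_k^0$ are its basic open sets. Two elements $a, b \in R$ are associates if $a = ub$ for some unit $u$ of $R$. For a unique factorization domain $R$ and $\alpha \in R^0$, the prime support $\operatorname{supp}(\alpha)$ is the set of associate classes of prime elements of $R$ that divide $\alpha$ (so it is empty when $\alpha$ is a unit). *)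

(* Defs.v *)
From HB Require Import structures.
From mathcomp Require Import all_boot all_order all_algebra.
From mathcomp Require Import boolp classical_sets topology.

Set Implicit Arguments.
Unset Strict Implicit.
Unset Printing Implicit Defensive.

Import GRing.Theory.

Local Open Scope classical_set_scope.
Local Open Scope ring_scope.

Section Ideals.
Variable R : idomainType.
Implicit Types (I J : set R) (k : R).

(* [idealr_closed] is not used because it excludes the unit ideal. *)
Definition ideal I : Prop :=
  [/\ I 0, forall x y, I x -> I y -> I (x + y) & forall a x, I x -> I (a * x)].

Definition principal_ideal k : set R := [set a * k | a in [set: R]].

Definition ideal_sum I J : set R := [set x + y | x in I & y in J].

End Ideals.

Definition is_pid (R : idomainType) : Prop :=
  forall I : set R, ideal I -> exists k : R, I = principal_ideal k.

Definition is_field (R : idomainType) : Prop :=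
  forall x : R, x != 0 -> x \is a GRing.unit.

Section PrimeSupport.
Variable R : idomainType.
Implicit Types a b p : R.

Definition divides a b : Prop := exists c, b = c * a.

Definition associates a b : Prop := exists2 u, u \is a GRing.unit & a = u * b.

Definition prime_element p : Prop :=
  [/\ p != 0, p \isn't a GRing.unit
    & forall a b, divides p (a * b) -> divides p a \/ divides p b].

Definition associate_class a : set R := [set b | associates b a].

(* A set of associate classes, hence a set of subsets of R. *)
Definition supp a : set (set R) :=
  [set associate_class p | p in [set p | prime_element p /\ divides p a]].

End PrimeSupport.

(* The set R^0 of nonzero elements, carrier of the space M(R). *)
Record macias (R : idomainType) :=
  Macias { macias_val : R ; macias_neq0 : macias_val != 0 }.

HB.instance Definition _ (R : idomainType) := [isSub for @macias_val R].
HB.instance Definition _ (R : idomainType) := [Choice of macias R by <:].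
HB.instance Definition _ (R : idomainType) :=
  isPointed.Build (macias R) (Macias (oner_neq0 R)).

Definition sigma0 (R : idomainType) (k : macias R) : set (macias R) :=
  [set s | ideal_sum (principal_ideal (macias_val k))
             (principal_ideal (macias_val s)) = [set: R]].

Section MaciasTopology.
Variable R : idomainType.

Lemma sigma0P (k s : macias R) :
  sigma0 k s <-> exists a b, a * val k + b * val s = 1.
Proof.
split=> [ks|[a [b ab1]]].
  have : [set: R] 1 by [].
  by rewrite -ks => -[_ [a _ <-]] [_ [b _ <-]] ab1; exists a, b.
apply/seteqP; split=> // x _.
exists (x * a * val k); first by exists (x * a).
exists (x * b * val s); first by exists (x * b).
by rewrite -!mulrA -mulrDr ab1 mulr1.
Qed.

Lemma sigma0_cover : \bigcup_(k in [set: macias R]) sigma0 k = [set: macias R].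
Proof.
apply/seteqP; split=> // s _; exists point => //; apply/sigma0P.
by exists 1, 0; rewrite mul0r addr0 mul1r.
Qed.

Lemma sigma0_join (k l t : macias R) :
  [set: macias R] k -> [set: macias R] l -> sigma0 k t -> sigma0 l t ->
  exists m, [/\ [set: macias R] m, sigma0 m t
              & sigma0 m `<=` sigma0 k `&` sigma0 l].
Proof.
move=> _ _ /sigma0P[a [b ab1]] /sigma0P[c [d cd1]].
exists (Macias (mulf_neq0 (macias_neq0 k) (macias_neq0 l))); split=> //.
  apply/sigma0P; exists (a * c), (b + a * val k * d) => /=.
  rewrite mulrDl [b * val t + _]addrC addrA mulrACA -[a * val k * d * val t]mulrA.
  by rewrite -mulrDr cd1 mulr1.
move=> s /sigma0P[x [y xy1]]; split; apply/sigma0P.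
  by exists (x * val l), y; rewrite -xy1 /= [val k * _]mulrC mulrA.
by exists (x * val k), y; rewrite -xy1 /= mulrA.
Qed.

HB.instance Definition _ :=
  isBaseTopological.Build (macias R) sigma0_cover sigma0_join.

End MaciasTopology.

(* Main.v *)
Require Import Defs.
From mathcomp Require Import all_boot all_order all_algebra.
From mathcomp Require Import boolp classical_sets topology.
Local Open Scope classical_set_scope.

(** A common prime divisor of [r] and [s] generates a proper ideal containing
    [<s> + <r>].  Conversely, if [<s> + <r>] is proper, it lies in a maximal
    ideal by Zorn's lemma, and a generator of that maximal ideal is a prime
    dividing both [r] and [s]. *)

Import GRing.Theory.
Local Open Scope ring_scope.

Section PrincipalIdealDomain.
Set Implicit Arguments.
Unset Strict Implicit.
Variable R : idomainType.
Implicit Types (I J M : set R) (k p q x : R).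

Lemma principal_idealP k x : principal_ideal k x <-> divides k x.
Proof. by split=> [[a _ <-]|[a ->]]; exists a. Qed.

Lemma principal_ideal_id k : principal_ideal k k.
Proof. by exists 1; rewrite ?mul1r. Qed.

Lemma ideal_principal k : ideal (principal_ideal k).
Proof.
split=> [|_ _ [a _ <-] [b _ <-]|a _ [b _ <-]].
- by exists 0; rewrite ?mul0r.
- by exists (a + b); rewrite ?mulrDl.
- by exists (a * b); rewrite ?mulrA.
Qed.

Lemma ideal_ideal_sum I J : ideal I -> ideal J -> ideal (ideal_sum I J).
Proof.
move=> [I0 ID IM] [J0 JD JM]; split.
- by exists 0 => //; exists 0 => //; rewrite addr0.
- move=> _ _ [x Ix [y Jy <-]] [z Iz [t Jt <-]].
  by exists (x + z); [exact: ID|exists (y + t); [exact: JD|rewrite addrACA]].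
- move=> a _ [x Ix [y Jy <-]].
  by exists (a * x); [exact: IM|exists (a * y); [exact: JM|rewrite mulrDr]].
Qed.

Lemma sub_ideal_suml I J : J 0 -> I `<=` ideal_sum I J.
Proof. by move=> J0 x Ix; exists x => //; exists 0 => //; rewrite addr0. Qed.

Lemma sub_ideal_sumr I J : I 0 -> J `<=` ideal_sum I J.
Proof. by move=> I0 x Jx; exists 0 => //; exists x => //; rewrite add0r. Qed.

Lemma ideal1 I : ideal I -> I 1 -> I = [set: R].
Proof.
by move=> [_ _ IM] I1; apply/seteqP; split=> // x _; rewrite -[x]mulr1; apply: IM.
Qed.

(** Zorn's lemma applies because the union of a nonempty chain of proper ideals above [I] is again
    one: any two of its elements lie in a common member of the chain, and no member contains [1]. *)
Lemma exists_maximal_ideal I : ideal I -> ~ I 1 ->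
  exists M, [/\ ideal M, ~ M 1, I `<=` M
    & forall J, ideal J -> ~ J 1 -> M `<=` J -> J `<=` M].
Proof.
move=> idI I1.
pose proper_above J := [/\ ideal J, ~ J 1 & I `<=` J].
(* [Zorn_bigcup] includes the empty chain, hence the vacuous case [set0]. *)
have [|M [PM maxM]] := @Zorn_bigcup R (fun J => J !=set0 -> proper_above J).
  move=> F FP Ftot [z [A FA Az]].
  have PF B x : F B -> B x -> proper_above B by move=> FB Bx; apply: FP => //; exists x.
  have [[A0 _ _] _ IA] := PF _ _ FA Az.
  split; last by move=> x /IA; exists A.
    split; first by exists A.
      move=> x y [B FB Bx] [C FC Cy].
      have [[_ BD _] _ _] := PF _ _ FB Bx; have [[_ CD _] _ _] := PF _ _ FC Cy.
      have [BC|CB] := Ftot _ _ FB FC.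
        by exists C => //; apply: CD => //; apply: BC.
      by exists B => //; apply: BD => //; apply: CB.
    move=> a x [B FB Bx]; have [[_ _ BM] _ _] := PF _ _ FB Bx.
    by exists B => //; apply: BM.
  by move=> [B FB B1]; have [_] := PF _ _ FB B1.
have [I0 _ _] := idI.
have M0 : M !=set0.
  (* If [M] were empty, [I], which contains [0], would be a strictly larger member of the family. *)
  apply: contrapT => Mempty; apply: (maxM I); last by move=> _; split.
  split; first by move=> x Mx; case: Mempty; exists x.
  by move=> IM; apply: Mempty; exists 0; apply: IM.
have [idM M1 IM] := PM M0.
exists M; split=> // J idJ J1 MJ; apply: contrapT => JM.
by apply: (maxM J) => // _; split=> // x /IM /MJ.
Qed.

(** The prime is a generator [p] of a maximal ideal above [I]: the nonzero element [x] forces [p] to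
    be nonzero, properness makes it a nonunit, and maximality gives primality. *)
Lemma exists_prime_dividing_ideal I x : is_pid R -> ideal I -> ~ I 1 ->
  I x -> x != 0 -> exists2 p, prime_element p & forall y, I y -> divides p y.
Proof.
move=> pidR idI I1 Ix x0.
have [M [idM M1 IM maxM]] := exists_maximal_ideal idI I1.
have [p Mp] := pidR M idM; exists p; last first.
  by move=> y /IM; rewrite Mp => /principal_idealP.
split.
- apply/eqP => p0; move: x0 (IM _ Ix); rewrite Mp p0 => /eqP x0 [a _].
  by rewrite mulr0 => /esym.
- apply/negP => up; apply: M1; rewrite Mp.
  by exists p^-1; rewrite // mulVr.
- move=> a b [c abE]; have [pa|npa] := pselect (divides p a); [by left|right].
  have idp := ideal_principal p; have ida := ideal_principal a.
  have [p0 _ _] := idp; have [a0 _ _] := ida.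
  have idS := ideal_ideal_sum idp ida.
  (* Bezout identity [y * p + z * a = 1]: were [<p> + <a>] proper, maximality of [M = <p>] would put
     [a] in [<p>]. *)
  have [_ [y _ <-] [_ [z _ <-] yz1]] :
      ideal_sum (principal_ideal p) (principal_ideal a) 1.
    apply: contrapT => S1; apply: npa; apply/principal_idealP; rewrite -Mp.
    apply: (maxM _ idS S1); first by rewrite Mp; exact: sub_ideal_suml.
    exact: sub_ideal_sumr (principal_ideal_id a).
  (* Multiply the Bezout identity by [b] and substitute [a * b = c * p]. *)
  exists (y * b + z * c).
  by rewrite -[LHS]mul1r -yz1 !mulrDl -!mulrA abE [p * b]mulrC.
Qed.

Lemma associates_refl p : associates p p.
Proof. by exists 1; rewrite ?unitr1 ?mul1r. Qed.

Lemma divides_associates p q x : associates p q -> divides p x -> divides q x.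
Proof. by move=> [u _ ->] [c ->]; exists (c * u); rewrite mulrA. Qed.

(** A shared class only yields associate primes, [p] dividing [r] and [q] dividing [s]; divisibility
    then passes from [q] to [p]. *)
Lemma supp_common_prime (r s : R) : supp r `&` supp s !=set0 <->
  exists p, [/\ prime_element p, divides p r & divides p s].
Proof.
split=> [[_ [[p [pp pr] <-] [q [_ qs] pq]]]|[p [pp pr ps]]].
  exists p; split=> //; apply: divides_associates qs.
  by have := associates_refl q; rewrite -[associates q q]/(associate_class q q) pq.
by exists (associate_class p); split; exists p.
Qed.

Lemma sigma0_supp (r s : macias R) : is_pid R ->
  sigma0 s r <-> supp (macias_val r) `&` supp (macias_val s) = set0.
Proof.
move=> pidR; split=> [/sigma0P[a [b ab1]]|rs0].
  apply: contrapT => /eqP/set0P/supp_common_prime[p [[_ /negP pU _] [c rE] [d sE]]].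
  (* Substituting [r = c * p] and [s = d * p] into [a * s + b * r = 1] exhibits an inverse of
     [p]. *)
  apply: pU; apply/unitrP; exists (a * d + b * c).
  by rewrite [p * _]mulrC mulrDl -!mulrA -rE -sE ab1.
have ids := ideal_principal (macias_val s); have idr := ideal_principal (macias_val r).
have [s0 _ _] := ids; have [r0 _ _] := idr.
have idS := ideal_ideal_sum ids idr.
apply: ideal1 => //; apply: contrapT => S1.
have Ss := sub_ideal_suml r0 (principal_ideal_id (macias_val s)).
have Sr := sub_ideal_sumr s0 (principal_ideal_id (macias_val r)).
(* The generator [s] serves as the nonzero element of the proper ideal [<s> + <r>]. *)
have [p pp pS] := exists_prime_dividing_ideal pidR idS S1 Ss (macias_neq0 s).
suff : supp (macias_val r) `&` supp (macias_val s) !=set0 by rewrite rs0 => -[].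
by apply/supp_common_prime; exists p; split=> //; apply: pS.
Qed.

End PrincipalIdealDomain.

Local Close Scope ring_scope.

Theorem corollary2p7 (R : idomainType) (pidR : is_pid R) (nfR : ~ is_field R) :
  (forall r s : macias R,
     sigma0 s r <-> supp (macias_val r) `&` supp (macias_val s) = set0) /\
  (forall s t : macias R,
     supp (macias_val s) = supp (macias_val t) -> sigma0 s = sigma0 t).
Proof.
split=> [r s|s t st]; first exact: sigma0_supp.
(* In this form the basic open set refers to [k] only through its support. *)
have sigma0E (k : macias R) : sigma0 k =
    [set r | supp (macias_val r) `&` supp (macias_val k) = set0].
  by apply/seteqP; split=> r /(sigma0_supp _ _ pidR).
by rewrite !sigma0E st.
Qed.
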